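(* Any (perhaps randomized) distributed algorithm in the CONGEST model that solves the weighted 2-spanner problem optimally requires $\Omega\!\left(\frac{n^2}{\log^2 n}\right)$ rounds on some $n$-vertex input graphs.
   Context: Weighted 2-spanner problem: the input is a connected undirected graph $G=(V,E)$ with non-negative edge weights $w(e)$ (all edges have length 1). A subgraph $H\subseteq E$ is a 2-spanner if for every edge $\{u,v\}\in E$ there is a path with at most 2 edges between $u$ and $v$ in $H$; the goal is to find $H$ minimizing $w(H)=\sum_{e\in H}w(e)$. Distributed setting: the input graph is the communication network; vertices have unique IDs and initially know their incident edges and weights; synchronous rounds; each vertex outputs a subset of its incident edges. CONGEST: each vertex may send an $O(\log n)$-bit message over each incident edge per round. *)

(* Defs.v *)
From HB Require Import structures.
From mathcomp Require Export all_boot all_order all_algebra.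
From mathcomp Require Export all_classical all_reals all_analysis.

Set Implicit Arguments.
Unset Strict Implicit.
Unset Printing Implicit Defensive.

Import Order.TTheory GRing.Theory Num.Theory.
Local Open Scope classical_set_scope.
Local Open Scope ring_scope.

(* An edge {u, v} is the two-element set [set u; v]; the values of [weight] on
   other sets are never used. *)
Record instance (R : realType) (n : nat) := Instance {
  adj : rel 'I_n;
  adj_sym : symmetric adj;
  adj_irr : irreflexive adj;
  adj_connected : forall u v, connect adj u v;
  weight : {set 'I_n} -> R;
  weight_ge0 : forall u v, adj u v -> 0 <= weight [set u; v]%SET;
  ident : 'I_n -> nat;
  ident_inj : injective ident
}.

Section Spanner.
Variables (R : realType) (n : nat) (I : instance R n).
Implicit Types H : {set {set 'I_n}}.

Definition edges : {set {set 'I_n}} :=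
  [set [set u; v] | u in 'I_n, v in 'I_n & adj I u v]%SET.

Definition spanner2 H : Prop :=
  H \subset edges /\
  forall u v, adj I u v ->
    exists p : seq 'I_n,
      [/\ path (fun x y => [set x; y]%SET \in H) u p,
          last u p = v & (size p <= 2)%N].

Definition cost H : R := \sum_(e in H) weight I e.

Definition min_spanner2 H : Prop :=
  spanner2 H /\ forall H', spanner2 H' -> cost H <= cost H'.

End Spanner.

(* The program run by every vertex, with messages of at most [b] bits.
   Neighbours are addressed by their identifiers: a function [nat -> option X]
   is a table with an entry exactly at the identifiers of the neighbours.
   - [init w i t] is the initial state of the vertex with identifier [i] whose
     incident edges have the weights [t], for the random outcome [w : Om].  The
     outcome is visible to all vertices, so shared randomness is allowed;
     private coins are the case where [w] is a family of independent tapes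
     indexed by identifiers and [init w i] reads only the tape of [i].
   - [send s j] is the message for neighbour [j].
   - [output s] is [None] until the vertex halts, and then gives irrevocably the
     neighbours [j] such that the edge to [j] is in the output of the vertex. *)
Record program (R Om : Type) (b : nat) := Program {
  state : Type;
  init : Om -> nat -> (nat -> option R) -> state;
  send : state -> nat -> b.-bseq bool;
  recv : state -> (nat -> option (b.-bseq bool)) -> state;
  output : state -> option (nat -> bool);
  output_stable : forall s m o, output s = Some o -> output (recv s m) = Some o
}.

Section Execution.
Variables (R : realType) (Om : Type) (b n : nat).
Variables (A : program R Om b) (I : instance R n).

Definition table (X : Type) (v : 'I_n) (f : 'I_n -> X) : nat -> option X :=
  fun j => omap f [pick u | adj I v u && (ident I u == j)].

Definition start (w : Om) : 'I_n -> state A :=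
  fun v => init A w (ident I v) (table v (fun u => weight I [set v; u]%SET)).

Definition round (s : 'I_n -> state A) : 'I_n -> state A :=
  fun v => recv (s v) (table v (fun u => send (s u) (ident I v))).

Definition run (t : nat) (w : Om) : 'I_n -> state A := iter t round (start w).

Definition halted (t : nat) (w : Om) : Prop :=
  forall v, output (run t w v) <> None.

Definition selects (t : nat) (w : Om) (u v : 'I_n) : bool :=
  if output (run t w u) is Some o then o (ident I v) else false.

Definition result (t : nat) (w : Om) : {set {set 'I_n}} :=
  [set [set u; v] | u in 'I_n, v in 'I_n & adj I u v && selects t w u v]%SET.

End Execution.

Section Randomized.
Variables (R : realType) (d : measure_display) (Om : measurableType d).
Variables (P : probability Om R) (b n : nat).
Variables (A : program R Om b).

Definition measurable_result (I : instance R n) : Prop :=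
  forall (t : nat) (H : {set {set 'I_n}}),
    measurable [set w | halted A I t w /\ result A I t w = H].

Definition solves_within (I : instance R n) (t : nat) : Prop :=
  ((2 / 3)%:E <=
    P [set w | halted A I t w /\ min_spanner2 I (result A I t w)])%E.

End Randomized.

(* Inputs whose identifiers lie in [0, idmax) and whose edge weights lie in
   [W]. *)
Definition admissible (R : realType) (n : nat) (idmax : nat) (W : set R)
    (I : instance R n) : Prop :=
  (forall v, (ident I v < idmax)%N) /\
  (forall u v, adj I u v -> W (weight I [set u; v]%SET)).

(* Main.v *)
Require Import Defs.
From mathcomp Require Import finset zify ring lra.
Set Implicit Arguments.
Unset Strict Implicit.
Unset Printing Implicit Defensive.
Import Order.TTheory GRing.Theory Num.Theory.
Local Open Scope ring_scope.

(** Two players hold subsets [x] and [y] of [k * k] cells, with [k] linear in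
    [n].  They build a graph whose maximum independent sets tell whether [x] and
    [y] intersect: an independent set of maximum size selects one row and one
    column on each side of the graph, binary-code gadgets crossing the cut force
    both sides to select the same cell, and an edge forbids every cell outside
    [x] (resp. [y]).  Only [O(log n)] edges cross the cut.  Minimum vertex cover
    reduces to weighted 2-spanner by splitting every vertex into the two ends of
    an edge of weight 1, with edges so heavy between non-matching ends that an
    optimal spanner never buys them.

    A fast algorithm thus gives a protocol of [O(t log^2 n)] bits for set
    disjointness on [k^2] points, which needs a number of bits linear in [k^2].
    For the latter, fix for every coordinate which player receives a uniform bit
    while the other one receives 0.  The set of inputs with a given transcript
    has coordinate biases whose squares sum to at most [8 ln (1 / density)],
    hence on average a transcript hardly reveals whether coordinate [j] is (0,0)
    or (0,1), nor whether it is (0,0) or (1,0).  By the cut-and-paste property of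
    rectangles and the triangle inequality for the Hellinger distance it hardly
    reveals whether it is (0,0) or (1,1) either, although this changes the
    answer. *)

(** * Biases of subsets of the cube *)

Section Level1.
Variables (R : realType) (M : finType).
Implicit Types (Z : {set {set M}}) (z : {set M}) (j : M).

Lemma card_setR : #|{: {set M}}|%:R = 2 ^+ #|M| :> R.
Proof. by rewrite -[in LHS]cardsT -powersetT card_powerset cardsT natrX. Qed.

(** From [1 - y <= exp (- y)] and its mirror image, the left side is at most [2 / (1 - y ^+ 2)], and
    [1 / (1 - y ^+ 2) <= 1 + 2 * y ^+ 2] for small [y]. *)
Lemma expR_sym_le (y : R) : `|y| <= 1 / 2 ->
  expR y + expR (- y) <= 2 * expR (2 * y ^+ 2).
Proof.
rewrite ler_norml => /andP[y1 y2].
have e1 : expR y * (1 - y) <= 1.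
  rewrite -[leRHS](expRxMexpNx_1 y) ler_wpM2l ?expR_ge0 //; exact: expR_ge1Dx.
have e2 : expR (- y) * (1 + y) <= 1.
  rewrite -[leRHS](expRxMexpNx_1 y) mulrC ler_wpM2r ?expR_ge0 //; exact: expR_ge1Dx.
have e3 : 1 + 2 * y ^+ 2 <= expR (2 * y ^+ 2) by exact: expR_ge1Dx.
apply: (@le_trans _ _ (2 * (1 + 2 * y ^+ 2))); last by rewrite ler_pM2l.
have y4 : y ^+ 2 <= 1 / 4 by nra.
have p : 0 < 1 - y ^+ 2 by lra.
rewrite -(ler_pM2r p).
have : expR y * (1 - y) * (1 + y) + expR (- y) * (1 + y) * (1 - y) <= 2.
  have -> : 2 = (1 + y) + (1 - y) :> R by ring.
  by apply: lerD; rewrite -[leRHS]mul1r ler_wpM2r //; lra.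
nra.
Qed.

Definition sgn_mem j z : R := if j \in z then 1 else -1.

Definition bias Z j : R := (\sum_(z in Z) sgn_mem j z) / #|Z|%:R.

Lemma normr_bias_le1 Z j : `|bias Z j| <= 1.
Proof.
rewrite /bias; have [->|Z0] := eqVneq Z set0; first by rewrite big_set0 mul0r normr0.
have c0 : 0 < #|Z|%:R :> R by rewrite ltr0n card_gt0.
rewrite normrM normfV (gtr0_norm c0) ler_pdivrMr // mul1r.
apply: le_trans (ler_norm_sum _ _ _) _.
rewrite -sum1_card natr_sum ler_sum // => z _.
by rewrite /sgn_mem; case: ifP; rewrite ?normrN normr1.
Qed.

(* Exponential moments: the average over [Z] of [exp (\sum_j v_j chi_j / 4)],
   where [v] is the bias, is at least [exp (\sum_j v_j ^+ 2 / 4)] by convexity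
   and at most [2 ^ #|M| / #|Z|] times its average over the whole cube. *)
Lemma sum_bias_sqr_le Z : Z != set0 ->
  \sum_j bias Z j ^+ 2 <= 8 * ln (2 ^+ #|M| / #|Z|%:R).
Proof.
move=> Z0; have c0 : 0 < #|Z|%:R :> R by rewrite ltr0n card_gt0.
set S := \sum_j _.
pose Y z := \sum_j bias Z j / 4 * sgn_mem j z.
have SY : \sum_(z in Z) Y z = #|Z|%:R * (S / 4).
  rewrite exchange_big /= /S mulr_suml mulr_sumr; apply: eq_bigr => j _.
  rewrite -mulr_sumr.
  have -> : \sum_(z in Z) sgn_mem j z = bias Z j * #|Z|%:R.
    by rewrite /bias divfK // gt_eqF.
  by field.
have lo : #|Z|%:R * expR (S / 4) <= \sum_(z in Z) expR (Y z).
  have -> : #|Z|%:R * expR (S / 4) =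
      \sum_(z in Z) expR (S / 4) * (1 + (Y z - S / 4)).
    rewrite -mulr_sumr big_split /= sumrB SY !sumr_const -[1 *+ _]/(_%:R).
    by rewrite -[_ *+ #|Z|]mulr_natl; ring.
  apply: ler_sum => z _.
  rewrite -[in leRHS](subrK (S / 4) (Y z)) expRD mulrC ler_wpM2r ?expR_ge0 //.
  exact: expR_ge1Dx.
have hi : \sum_(z in Z) expR (Y z) <= 2 ^+ #|M| * expR (S / 8).
  apply: (@le_trans _ _ (\sum_z expR (Y z))).
    rewrite [leRHS](bigID (mem Z)) /= lerDl sumr_ge0 // => z _; exact: expR_ge0.
  have -> : \sum_z expR (Y z) =
      \prod_j (expR (bias Z j / 4) + expR (- (bias Z j / 4))).
    rewrite bigA_distr; apply: eq_bigr => z _.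
    rewrite /Y expR_sum; apply: eq_bigr => j _; rewrite /sgn_mem.
    by case: ifP; rewrite ?mulr1 ?mulrN1.
  have -> : 2 ^+ #|M| * expR (S / 8) = \prod_j (2 * expR (2 * (bias Z j / 4) ^+ 2)).
    rewrite big_split /= prodr_const -expR_sum -mulr_sumr /S mulr_suml; congr (_ * expR _).
    rewrite mulr_sumr; apply: eq_bigr => j _; by field.
  apply: ler_prod => j _; rewrite addr_ge0 ?expR_ge0 //=.
  apply: expR_sym_le; rewrite normrM (@ger0_norm _ (4^-1)) //.
  have := normr_bias_le1 Z j; lra.
have {lo hi} : #|Z|%:R * expR (S / 4) <= 2 ^+ #|M| * expR (S / 8).
  exact: le_trans lo hi.
have -> : S / 4 = S / 8 + S / 8 by field.
rewrite expRD mulrA ler_pM2r ?expR_gt0 // => le8.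
have : expR (S / 8) <= 2 ^+ #|M| / #|Z|%:R by rewrite ler_pdivlMr // mulrC.
rewrite -ler_ln ?posrE ?expR_gt0 ?divr_gt0 ?exprn_gt0 // expRK; lra.
Qed.

(** Factor [a - b] through the square roots; the squared sum of the roots dominates [a + b]. This
    turns squared biases into Hellinger distances. *)
Lemma sqrB_sqrt_le (a b : R) : 0 <= a -> 0 <= b ->
  (Num.sqrt a - Num.sqrt b) ^+ 2 * (a + b) <= (a - b) ^+ 2.
Proof.
move=> a0 b0; have := sqr_sqrtr a0; have := sqr_sqrtr b0.
have := sqrtr_ge0 a; have := sqrtr_ge0 b.
move: (Num.sqrt a) (Num.sqrt b) => p q q0 p0 <- <-.
have -> : (p ^+ 2 - q ^+ 2) ^+ 2 = (p - q) ^+ 2 * (p + q) ^+ 2 by ring.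
rewrite ler_wpM2l ?sqr_ge0 //; nra.
Qed.

Variable (T : finType) (f : {set M} -> T).

Definition fiber j (b : bool) (t : T) : {set {set M}} :=
  [set z : {set M} | ((j \in z) == b) && (f z == t)].

(** Each value [t] contributes at most its class size times its sum of squared biases; weighted by
    class size, the terms [ln (1 / density)] form an entropy, at most [ln #|T|]. *)
Lemma sum_sqrt_fiber_le :
  \sum_j \sum_t (Num.sqrt #|fiber j true t|%:R - Num.sqrt #|fiber j false t|%:R) ^+ 2
    <= 8 * 2 ^+ #|M| * ln #|T|%:R :> R.
Proof.
pose Z t := [set z : {set M} | f z == t].
have T0 : 0 < #|T|%:R :> R by rewrite ltr0n; apply/card_gt0P; exists (f set0).
rewrite exchange_big /=.
have sZ : \sum_t #|Z t|%:R = 2 ^+ #|M| :> R.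
  rewrite -card_setR -natr_sum -[in RHS]sum1_card; congr _%:R.
  rewrite (partition_big f xpredT) //=; apply: eq_bigr => t _.
  by rewrite sum1dep_card.
have cf t j : #|Z t|%:R = #|fiber j true t|%:R + #|fiber j false t|%:R :> R.
  rewrite -natrD; congr _%:R.
  have <- : Z t :&: [set z : {set M} | j \in z] = fiber j true t.
    by apply/setP => z; rewrite !inE andbC eqb_id.
  have <- : Z t :\: [set z : {set M} | j \in z] = fiber j false t.
    by apply/setP => z; rewrite !inE eqbF_neg.
  by rewrite cardsID.
have df t j : \sum_(z in Z t) sgn_mem j z
    = #|fiber j true t|%:R - #|fiber j false t|%:R :> R.
  rewrite (bigID (fun z => j \in z)) /= -!sum1_card !natr_sum -sumrN.
  congr (_ + _); apply: eq_big => z; rewrite ?inE ?eqb_id ?eqbF_neg 1?andbC //.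
    by rewrite /sgn_mem => /andP[->].
  by rewrite /sgn_mem => /andP[/negbTE->].
(* The last two terms come from [ln q <= q - 1] and cancel when summed over [t]. *)
have st t : \sum_j (Num.sqrt #|fiber j true t|%:R - Num.sqrt #|fiber j false t|%:R) ^+ 2
    <= 8 * (#|Z t|%:R * ln #|T|%:R + 2 ^+ #|M| / #|T|%:R - #|Z t|%:R) :> R.
  have [Zt0|Z0] := eqVneq (Z t) set0.
    rewrite Zt0 cards0 mul0r add0r subr0 big1 ?mulr_ge0 ?invr_ge0 ?ler0n ?exprn_ge0 //.
    move=> j _; have := cf t j; rewrite Zt0 cards0 -natrD => /eqP.
    rewrite eqr_nat eq_sym addn_eq0 => /andP[/eqP-> /eqP->]; by rewrite subrr expr0n.
  have c0 : 0 < #|Z t|%:R :> R by rewrite ltr0n card_gt0.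
  apply: (@le_trans _ _ (#|Z t|%:R * \sum_j bias (Z t) j ^+ 2)).
    rewrite mulr_sumr; apply: ler_sum => j _.
    rewrite /bias df expr_div_n.
    have -> : forall q : R, #|Z t|%:R * (q / #|Z t|%:R ^+ 2) = q / #|Z t|%:R.
      by move=> q; field; rewrite gt_eqF.
    by rewrite ler_pdivlMr // {1}(cf t j); apply: sqrB_sqrt_le; rewrite ler0n.
  apply: (@le_trans _ _ (#|Z t|%:R * (8 * ln (2 ^+ #|M| / #|Z t|%:R)))).
    by rewrite ler_wpM2l ?sum_bias_sqr_le // ltW.
  have -> : 2 ^+ #|M| / #|Z t|%:R = (2 ^+ #|M| / #|Z t|%:R / #|T|%:R) * #|T|%:R :> R.
    by rewrite divfK // gt_eqF.
  set q := _ / _ / _; have q0 : 0 < q by rewrite !divr_gt0 ?exprn_gt0.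
  rewrite lnM ?posrE //.
  have lq : ln q <= q - 1.
    have := expR_ge1Dx (ln q); rewrite lnK ?posrE //; lra.
  have -> : 2 ^+ #|M| / #|T|%:R = #|Z t|%:R * q.
    by rewrite /q; field; rewrite !gt_eqF.
  move: (ln #|T|%:R) lq c0 => l; nra.
have sc : \sum_(t : T) (2 ^+ #|M| / #|T|%:R) = 2 ^+ #|M| :> R.
  by rewrite sumr_const -[LHS]mulr_natr divfK ?gt_eqF.
apply: (le_trans (ler_sum _ (fun t _ => st t))).
rewrite -mulr_sumr sumrB big_split /= -mulr_suml sZ sc addrK.
by rewrite mulrA.
Qed.
End Level1.

(** * Set disjointness *)

Section SubsetSums.
Variables (R : realType) (M : finType) (j : M).
Implicit Types (z d : {set M}).

Lemma setU1_setD1_eq z : (((j |: z) :\ j)%SET == z) = (j \notin z).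
Proof.
have [jz|jz] := boolP (j \in z); last by rewrite setU1K ?eqxx.
by apply/eqP => /setP/(_ j); rewrite !inE eqxx jz.
Qed.

Lemma sum_split_mem (phi : {set M} -> R) :
  \sum_z phi z = \sum_(z : {set M} | j \notin z) (phi z + phi (j |: z)%SET).
Proof.
rewrite big_split /= (bigID (fun z : {set M} => j \notin z)) /=; congr (_ + _).
rewrite (reindex_onto (fun z => j |: z)%SET (fun z => z :\ j)%SET) /=.
  by apply: eq_bigl => z; rewrite negbK setU11 setU1_setD1_eq.
by move=> z; rewrite negbK => jz; rewrite setD1K.
Qed.

Lemma card_set_notin : #|[set z : {set M} | j \notin z]|%:R = 2 ^+ #|M| / 2 :> R.
Proof.
have -> : 2 ^+ #|M| = \sum_(z : {set M}) 1 :> R.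
  by rewrite -card_setR -sum1_card natr_sum.
rewrite sum_split_mem -sum1_card natr_sum mulr_suml.
by apply: eq_big => z; rewrite ?inE // => _; field.
Qed.

End SubsetSums.

Section Disjointness.
Variables (R : realType) (M T W : finType).
Variables (F : W -> {set M} -> {set M} -> T) (mu : W -> R) (g : T -> bool).
Hypothesis mu_ge0 : forall w, 0 <= mu w.
Hypothesis mu_sum1 : \sum_w mu w = 1.
(** All that is kept of a protocol: for fixed randomness, the inputs with a given transcript form a
    combinatorial rectangle. *)
Hypothesis F_rect : forall w x y x' y', F w x y = F w x' y' -> F w x y' = F w x y.
Hypothesis F_correct : forall x y,
  2 / 3 <= \sum_w mu w * (g (F w x y) == (x :&: y != set0)%SET)%:R.

Section Coordinate.
Variables (w : W) (j : M) (d : {set M}).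
Hypothesis jd : j \notin d.
Implicit Types (z : {set M}) (a b : bool).

Definition add_if a z : {set M} := if a then (j |: z)%SET else z.

(** [d] lists the coordinates whose random bit goes to the first player, so the two inputs read off
    [z] are disjoint; coordinate [j] is then set by hand to [(a, b)]. *)
Definition cell a b (t : T) : {set {set M}} :=
  [set z : {set M} | (j \notin z) &&
     (F w (add_if a (z :&: d)%SET) (add_if b (z :\: d)%SET) == t)].

Lemma in_cell a b t z : (z \in cell a b t) = (j \notin z) &&
  (F w (add_if a (z :&: d)%SET) (add_if b (z :\: d)%SET) == t).
Proof. by rewrite inE. Qed.

Lemma cell_fiber0 t : fiber (fun z => F w (z :&: d)%SET (z :\: d)%SET) j false t
  = cell false false t.
Proof. by apply/setP => z; rewrite !inE eqbF_neg. Qed.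

(** Putting [j] into [d] hands this coordinate to the first player, which changes neither input when
    [z] avoids [j]. So [d] and [j |: d] share the reference cell (0,0). *)
Lemma cell_fiberU0 t :
  fiber (fun z => F w (z :&: (j |: d))%SET (z :\: (j |: d))%SET) j false t
  = cell false false t.
Proof.
apply/setP => z; rewrite !inE eqbF_neg; have [//|jz/=] := boolP (j \in z).
have -> : (z :&: (j |: d))%SET = (z :&: d)%SET.
  by apply/setP => i; rewrite !inE; case: eqP => //= ->; rewrite (negbTE jz).
have -> // : (z :\: (j |: d))%SET = (z :\: d)%SET.
by apply/setP => i; rewrite !inE; case: eqP => //= ->; rewrite (negbTE jz) andbF.
Qed.

Lemma card_setU1_cell a b t (A : {set {set M}}) :
  (forall z, j \notin z -> (j |: z \in A)%SET = (z \in cell a b t)) ->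
  (forall z, z \in A -> j \in z) -> #|A| = #|cell a b t|.
Proof.
move=> hA Aj; have -> : A = [set (j |: z)%SET | z in cell a b t].
  apply/setP => z; apply/idP/imsetP => [zA|[z' z'c ->]].
    exists (z :\ j)%SET; last by rewrite setD1K // Aj.
    by rewrite -hA ?setD11 // setD1K // Aj.
  by rewrite hA //; move: z'c; rewrite inE => /andP[].
rewrite card_in_imset // => z z'; rewrite !inE => /andP[jz _] /andP[jz' _] e.
by rewrite -(setU1K jz) e setU1K.
Qed.

Lemma card_fiber1 t :
  #|fiber (fun z => F w (z :&: d)%SET (z :\: d)%SET) j true t| = #|cell false true t|.
Proof.
apply: card_setU1_cell => [z jz|z]; rewrite !inE ?eqb_id; last by case/andP.
rewrite eqxx jz /=; congr (F w _ _ == t); apply/setP => i; rewrite !inE.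
  by case: eqP => //= ->; rewrite (negbTE jd) andbF.
by case: eqP => //= ->; rewrite jd.
Qed.

Lemma card_fiberU1 t :
  #|fiber (fun z => F w (z :&: (j |: d))%SET (z :\: (j |: d))%SET) j true t|
  = #|cell true false t|.
Proof.
apply: card_setU1_cell => [z jz|z]; rewrite !inE ?eqb_id; last by case/andP.
rewrite eqxx jz /=; congr (F w _ _ == t); apply/setP => i; rewrite !inE.
  by case: eqP => //= ->; rewrite (negbTE jz).
by case: eqP => //= ->; rewrite (negbTE jz) andbF.
Qed.

Definition swap_out (p : {set M} * {set M}) : {set M} * {set M} :=
  ((p.1 :&: d) :|: (p.2 :\: d), (p.2 :&: d) :|: (p.1 :\: d))%SET.

Lemma glueI z z' : (((z :&: d) :|: (z' :\: d)) :&: d = z :&: d)%SET.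
Proof. by apply/setP => i; rewrite !inE; case: (i \in d); rewrite ?andbF ?andbT ?orbF. Qed.

Lemma glueD z z' : (((z :&: d) :|: (z' :\: d)) :\: d = z' :\: d)%SET.
Proof. by apply/setP => i; rewrite !inE; case: (i \in d); rewrite ?andbF ?andbT ?orbF. Qed.

Lemma swap_outK : involutive swap_out.
Proof.
by case=> z z'; rewrite /swap_out /= !glueI !glueD !setID.
Qed.

Lemma notin_glue z z' : j \notin z -> j \notin z' ->
  j \notin ((z :&: d) :|: (z' :\: d))%SET.
Proof. by move=> jz jz'; rewrite !inE (negbTE jz) (negbTE jz') andbF. Qed.

(** Exchanging the second player's inputs between two points with transcript [t] keeps [t], by the
    rectangle property, and [swap_out] is injective. *)
Lemma cell_paste_le a b a' b' t :
  (#|cell a b t| * #|cell a' b' t| <= #|cell a b' t| * #|cell a' b t|)%N.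
Proof.
rewrite -!cardsX -(card_imset _ (inv_inj swap_outK)); apply: subset_leq_card.
apply/fintype.subsetP => _ /imsetP[[z z'] + ->].
rewrite !in_setX !in_cell /= => /andP[/andP[jz /eqP e] /andP[jz' /eqP e']].
rewrite !notin_glue // !glueI !glueD /=.
have r1 := F_rect (etrans e (esym e')); have r2 := F_rect (etrans e' (esym e)).
by rewrite r1 r2 e e' eqxx.
Qed.

Lemma cell_paste t :
  (#|cell true false t| * #|cell false true t| = #|cell true true t| * #|cell false false t|)%N.
Proof. by apply/eqP; rewrite eqn_leq !cell_paste_le. Qed.

Lemma sum_cell a b (G : T -> R) :
  \sum_t G t * #|cell a b t|%:R =
  \sum_(z : {set M} | j \notin z) G (F w (add_if a (z :&: d)%SET) (add_if b (z :\: d)%SET)).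
Proof.
rewrite [RHS](partition_big (fun z => F w (add_if a (z :&: d)%SET) (add_if b (z :\: d)%SET)) xpredT) //=.
apply: eq_bigr => t _; rewrite -sum1_card natr_sum mulr_sumr.
by apply: eq_big => z; rewrite ?inE // => /andP[_ /eqP->]; rewrite mulr1.
Qed.

Definition sqrt_cell a b t : R := Num.sqrt #|cell a b t|%:R.

Lemma sqr_sqrt_cell a b t : sqrt_cell a b t ^+ 2 = #|cell a b t|%:R.
Proof. by rewrite sqr_sqrtr. Qed.

Lemma sum_cell1 a b : \sum_t sqrt_cell a b t ^+ 2 = 2 ^+ #|M| / 2.
Proof.
under eq_bigr => t _ do rewrite sqr_sqrt_cell -[_%:R]mul1r.
rewrite (sum_cell a b (fun=> 1)) -(card_set_notin R j) -sum1_card natr_sum.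
by apply: eq_bigl => z; rewrite inE.
Qed.

(** The vectors [sqrt_cell a b] have equal norms, so distances depend only on inner products, and
    [cell_paste] equates that of (1,1) with (0,0) to that of (1,0) with (0,1). The rest is the
    squared triangle inequality. *)
Lemma hellinger_paste :
  \sum_t (sqrt_cell true true t - sqrt_cell false false t) ^+ 2 <=
  2 * (\sum_t (sqrt_cell true false t - sqrt_cell false false t) ^+ 2 +
       \sum_t (sqrt_cell false true t - sqrt_cell false false t) ^+ 2).
Proof.
have E (a b a' b' : bool) : \sum_t (sqrt_cell a b t - sqrt_cell a' b' t) ^+ 2 =
    2 ^+ #|M| - 2 * \sum_t sqrt_cell a b t * sqrt_cell a' b' t.
  have -> : 2 ^+ #|M| = 2 ^+ #|M| / 2 + 2 ^+ #|M| / 2 :> R by field.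
  rewrite -{1}(sum_cell1 a b) -(sum_cell1 a' b') mulr_sumr -big_split -sumrB /=.
  by apply: eq_bigr => t _; ring.
rewrite [leLHS]E.
have -> : \sum_t sqrt_cell true true t * sqrt_cell false false t =
          \sum_t sqrt_cell true false t * sqrt_cell false true t.
  by apply: eq_bigr => t _; rewrite /sqrt_cell -!sqrtrM ?ler0n // -!natrM cell_paste.
rewrite -E -big_split mulr_sumr /=; apply: ler_sum => t _.
have := sqr_ge0 (sqrt_cell true false t - sqrt_cell false false t
  + (sqrt_cell false true t - sqrt_cell false false t)).
lra.
Qed.

End Coordinate.

(** With (0,0) at [j] the inputs are disjoint, with (1,1) they meet: the acceptance probabilities
    differ by at least 1/3 for each of the [2 ^+ #|M| / 2] sets [z]. *)
Lemma separation j (d : {set M}) : j \notin d ->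
  2 ^+ #|M| / 72 <=
  \sum_w mu w * \sum_t (sqrt_cell w j d true true t - sqrt_cell w j d false false t) ^+ 2.
Proof.
move=> jd; set h : R := 2 ^+ #|M|.
pose G t : R := (g t)%:R.
pose X w z a : R := G (F w (add_if j a (z :&: d)%SET) (add_if j a (z :\: d)%SET)).
have hz : \sum_(z : {set M} | j \notin z) 1 = h / 2.
  rewrite -(card_set_notin R j) -sum1_card natr_sum.
  by apply: eq_bigl => z; rewrite inE.
have hi : h / 3 <= \sum_w mu w * \sum_(z : {set M} | j \notin z) X w z true.
  have -> : h / 3 = \sum_(z : {set M} | j \notin z) (2 / 3).
    by rewrite -[2 / 3]mul1r -mulr_suml hz; field.
  under [leRHS]eq_bigr => w _ do rewrite mulr_sumr.
  rewrite exchange_big /=; apply: ler_sum => z jz.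
  apply: le_trans (F_correct (j |: (z :&: d))%SET (j |: (z :\: d))%SET) _.
  apply: ler_sum => w _; rewrite /X /G /add_if.
  suff -> : ((j |: z :&: d) :&: (j |: z :\: d) != set0)%SET by rewrite eqb_id.
  by apply/set0Pn; exists j; rewrite !inE eqxx.
have lo : \sum_w mu w * \sum_(z : {set M} | j \notin z) X w z false <= h / 6.
  have -> : h / 6 = \sum_(z : {set M} | j \notin z) (1 / 3).
    by rewrite -[1 / 3]mul1r -mulr_suml hz; field.
  under eq_bigr => w _ do rewrite mulr_sumr.
  rewrite exchange_big /=; apply: ler_sum => z jz.
  have := F_correct (z :&: d)%SET (z :\: d)%SET.
  have -> : ((z :&: d) :&: (z :\: d) != set0)%SET = false.
    by apply/negbTE; rewrite negbK; apply/eqP/setP => i; rewrite !inE; case: (i \in d); rewrite ?andbF.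
  suff -> : \sum_w mu w * (g (F w (z :&: d)%SET (z :\: d)%SET) == false)%:R
     = 1 - \sum_w mu w * X w z false.
    by move: (\sum_w mu w * X w z false) => s; lra.
  rewrite -[Y in _ = Y - _]mu_sum1 -sumrB; apply: eq_bigr => w _; rewrite /X /G /=.
  by case: (g _); rewrite /= ?mulr1 ?mulr0 ?subrr ?subr0.
(* By AM-GM, [p ^+ 2 - q ^+ 2 <= 6 * (p - q) ^+ 2 + (p ^+ 2 + q ^+ 2) / 12]; the last term uses up
   only half of the gap [h / 6]. *)
have key w : \sum_(z : {set M} | j \notin z) X w z true -
      \sum_(z : {set M} | j \notin z) X w z false <=
    6 * \sum_t (sqrt_cell w j d true true t - sqrt_cell w j d false false t) ^+ 2 + h / 12.
  rewrite /X -!(sum_cell w j d _ _ G) -sumrB.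
  have -> : h / 12 = (h / 2 + h / 2) / 12 by field.
  rewrite /h -{1}(sum_cell1 w j d true true) -(sum_cell1 w j d false false).
  rewrite -big_split /= mulr_suml mulr_sumr -big_split /=.
  apply: ler_sum => t _; rewrite -!sqr_sqrt_cell /G.
  move: (sqrt_cell _ _ _ _ _ _) (sqrt_cell _ _ _ _ _ _) => q p.
  have := sqr_ge0 (12 * (p - q) - (p + q)); have := sqr_ge0 (p - q); have := sqr_ge0 (p + q).
  by case: (g t) => /=; rewrite ?mul1r ?mul0r; nra.
have : \sum_w mu w * \sum_(z : {set M} | j \notin z) X w z true -
    \sum_w mu w * \sum_(z : {set M} | j \notin z) X w z false <=
  6 * \sum_w mu w * \sum_t (sqrt_cell w j d true true t - sqrt_cell w j d false false t) ^+ 2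
  + h / 12.
  have -> : h / 12 = \sum_w mu w * (h / 12) by rewrite -mulr_suml mu_sum1 mul1r.
  rewrite -sumrB mulr_sumr -big_split /=.
  apply: ler_sum => w _; rewrite -mulrBr.
  apply: le_trans (ler_wpM2l (mu_ge0 w) (key w)) _; rewrite le_eqVlt; apply/orP; left.
  by apply/eqP; ring.
by move: hi lo; rewrite -/h; lra.
Qed.

(* Randomized communication complexity of set disjointness: [F w x y] is the
   transcript on the inputs [x] and [y] for the random outcome [w]. *)
Theorem disjointness_lower_bound : #|M|%:R <= 2304 * ln #|T|%:R :> R.
Proof.
pose f w d z := F w (z :&: d)%SET (z :\: d)%SET.
pose term w d j : R := \sum_t
  (Num.sqrt #|fiber (f w d) j true t|%:R - Num.sqrt #|fiber (f w d) j false t|%:R) ^+ 2.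
set h : R := 2 ^+ #|M|; have h0 : 0 < h by rewrite exprn_gt0.
have hd : \sum_(d : {set M}) 1 = h.
  by rewrite /h -card_setR -sum1_card natr_sum.
have hi : \sum_w mu w * \sum_d \sum_j term w d j <= h * (8 * h * ln #|T|%:R).
  have -> : h * (8 * h * ln #|T|%:R) = \sum_w mu w * (h * (8 * h * ln #|T|%:R)).
    by rewrite -mulr_suml mu_sum1 mul1r.
  apply: ler_sum => w _.
  apply: ler_wpM2l => //; rewrite -{1}hd mulr_suml; apply: ler_sum => d _.
  by rewrite mul1r; exact: sum_sqrt_fiber_le.
(* Pair [d] with [j |: d]: by [hellinger_paste], each of the [h / 2] pairs contributes at least half
   of the separation [h / 72]. *)
have lo j : h ^+ 2 / 288 <= \sum_w mu w * \sum_d term w d j.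
  under [leRHS]eq_bigr => w _ do rewrite (sum_split_mem j) mulr_sumr.
  rewrite exchange_big /=.
  have -> : h ^+ 2 / 288 = \sum_(d : {set M} | j \notin d) (h / 144).
    have -> : h ^+ 2 / 288 = (h / 2) * (h / 144) by field.
    rewrite -{1}(card_set_notin R j) -sum1_card natr_sum mulr_suml.
    by apply: eq_big => d; rewrite ?inE // mul1r.
  apply: ler_sum => d jd.
  have := separation jd; rewrite -/h => sep.
  apply: (@le_trans _ _ (1 / 2 * \sum_w mu w * \sum_t
    (sqrt_cell w j d true true t - sqrt_cell w j d false false t) ^+ 2)); first lra.
  rewrite mulr_sumr; apply: ler_sum => w _.
  rewrite mulrCA; apply: ler_wpM2l => //.
  have := hellinger_paste w j d.
  have -> : \sum_t (sqrt_cell w j d true false t - sqrt_cell w j d false false t) ^+ 2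
            = term w (j |: d)%SET j.
    by apply: eq_bigr => t _; rewrite /f card_fiberU1 // cell_fiberU0.
  have -> : \sum_t (sqrt_cell w j d false true t - sqrt_cell w j d false false t) ^+ 2
            = term w d j.
    by apply: eq_bigr => t _; rewrite /f card_fiber1 // cell_fiber0.
  lra.
have : #|M|%:R * (h ^+ 2 / 288) <= h * (8 * h * ln #|T|%:R).
  apply: le_trans hi.
  have -> : \sum_w mu w * \sum_d \sum_j term w d j = \sum_j \sum_w mu w * \sum_d term w d j.
    rewrite [RHS]exchange_big /=; apply: eq_bigr => w _.
    by rewrite -mulr_sumr exchange_big.
  rewrite -sum1_card natr_sum mulr_suml; apply: ler_sum => j _.
  by rewrite mul1r lo.
have -> : h * (8 * h * ln #|T|%:R) = (2304 * ln #|T|%:R) * (h ^+ 2 / 288) by field.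
by rewrite ler_pM2r ?divr_gt0 ?exprn_gt0 ?ltr0n.
Qed.

End Disjointness.

(** * From vertex cover to 2-spanner *)

Lemma set2_eq (T : finType) (a b c d : T) : c != d ->
  [set a; b] = [set c; d] -> (a = c /\ b = d) \/ (a = d /\ b = c).
Proof.
move=> cd e.
have /set2P[ac|ad] : a \in [set c; d] by rewrite -e set21.
- left; split=> //; have : d \in [set a; b] by rewrite e set22.
  by rewrite ac in_set2 eq_sym (negbTE cd) => /eqP.
- right; split=> //; have : c \in [set a; b] by rewrite e set21.
  by rewrite ad in_set2 (negbTE cd) => /eqP.
Qed.

Section VertexCoverSpanner.
Variables (R : realType) (Q : finType) (E : rel Q) (side : Q -> bool) (p n : nat).
Hypothesis E_sym : symmetric E.
Hypothesis E_irr : irreflexive E.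

(* Every vertex [q] of the graph [E] has the two ends [var_vtx q false] and
   [var_vtx q true], and [mid_vtx q], which spans the edge between them at no
   cost.  The hubs, one per side, make the graph connected; the [p] other vertices
   are padding. *)
Definition vtx : finType := ((Q * option bool) + (bool + 'I_p))%type.

Definition var_vtx (q : Q) (a : bool) : vtx := inl (q, Some a).
Definition mid_vtx (q : Q) : vtx := inl (q, None).
Definition hub_vtx (b : bool) : vtx := inr (inl b).

(** An edge of [E] yields all four edges between the ends: those joining equal ends will be free,
    those joining opposite ends heavy. *)
Definition vadj : rel vtx := fun u v =>
  match u, v with
  | inl (q, Some a), inl (q', Some b) => if q == q' then a != b else E q q'
  | inl (q, Some _), inl (q', None) => q == q'
  | inl (q, None), inl (q', Some _) => q == q'
  | inl (q, None), inr (inl b) => side q == b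
  | inr (inl b), inl (q, None) => side q == b
  | inr (inl b), inr (inl b') => b != b'
  | inr (inl b), inr (inr _) => b
  | inr (inr _), inr (inl b) => b
  | _, _ => false
  end.

Lemma vadj_sym : symmetric vadj.
Proof.
move=> [[q [a|]]|[b|i]] [[q' [a'|]]|[b'|i']] //=;
  rewrite 1?[q' == q]eq_sym 1?[a' == a]eq_sym 1?[b' == b]eq_sym 1?E_sym //.
Qed.

Lemma vadj_irr : irreflexive vadj.
Proof. by move=> [[q [a|]]|[b|i]] /=; rewrite ?eqxx. Qed.

Hypothesis card_vtx : #|vtx| = n.

Definition enc (v : vtx) : 'I_n := cast_ord card_vtx (enum_rank v).
Definition dec (i : 'I_n) : vtx := enum_val (cast_ord (esym card_vtx) i).

Lemma encK : cancel enc dec.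
Proof. by move=> v; rewrite /enc /dec cast_ordK enum_rankK. Qed.

Lemma decK : cancel dec enc.
Proof. by move=> v; rewrite /enc /dec enum_valK cast_ordKV. Qed.

Lemma enc_inj : injective enc. Proof. exact: can_inj encK. Qed.

Definition var_edge (q q' : Q) : {set 'I_n} :=
  [set enc (var_vtx q false); enc (var_vtx q' true)].

Definition edge_weight (S : {set 'I_n}) : R :=
  if [exists q, S == var_edge q q] then 1
  else if [exists q, exists q', S == var_edge q q'] then n%:R else 0.

Lemma edge_weight_ge0 S : 0 <= edge_weight S.
Proof. by rewrite /edge_weight; do 2! case: ifP => // _; rewrite ler0n. Qed.

Lemma enc_var_neq q q' : enc (var_vtx q false) != enc (var_vtx q' true).
Proof. by apply/eqP => /enc_inj. Qed.

Lemma var_edge_inj q q' r r' : var_edge q q' = var_edge r r' -> q = r /\ q' = r'.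
Proof. by case/(set2_eq (enc_var_neq _ _)) => -[] /enc_inj e1 /enc_inj e2; case: e1; case: e2. Qed.

Lemma edge_weight_var q q' : edge_weight (var_edge q q') = if q == q' then 1 else n%:R.
Proof.
rewrite /edge_weight; case: existsP => [[r /eqP/var_edge_inj[-> ->]]|nr]; first by rewrite eqxx.
case: eqVneq => [qq|_]; first by case: nr; exists q; rewrite qq.
case: existsP => // -[]; exists q; apply/existsP; exists q'; exact: eqxx.
Qed.

Lemma edge_weight_neq0 S : edge_weight S != 0 -> exists q q', S = var_edge q q'.
Proof.
rewrite /edge_weight; case: existsP => [[q /eqP->]|_]; first by exists q, q.
by case: existsP => [[q /existsP[q' /eqP->]]|_]; [exists q, q'|rewrite eqxx].
Qed.

Definition adj_ord : rel 'I_n := fun u v => vadj (dec u) (dec v).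

Lemma adj_ord_sym : symmetric adj_ord. Proof. by move=> u v; exact: vadj_sym. Qed.
Lemma adj_ord_irr : irreflexive adj_ord. Proof. by move=> u; exact: vadj_irr. Qed.

Lemma adj_enc u v : adj_ord (enc u) (enc v) = vadj u v.
Proof. by rewrite /adj_ord !encK. Qed.

Lemma adj_ord_connected u v : connect adj_ord u v.
Proof.
have hub w : connect adj_ord (enc w) (enc (hub_vtx true)).
  have hubs b : connect adj_ord (enc (hub_vtx b)) (enc (hub_vtx true)).
    by case: b => //; apply: connect1; rewrite adj_enc.
  have mid q : connect adj_ord (enc (mid_vtx q)) (enc (hub_vtx true)).
    apply: connect_trans (hubs (side q)); apply: connect1; rewrite adj_enc /=; exact: eqxx.
  case: w => [[q [a|]]|[b|i]]; [|exact: mid|exact: hubs|]; last first.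
    by apply: connect1; rewrite adj_enc.
  apply: connect_trans (mid q); apply: connect1; rewrite adj_enc /=; exact: eqxx.
rewrite -(decK u) -(decK v); apply: connect_trans (hub _) _.
by rewrite (sym_connect_sym adj_ord_sym).
Qed.

Definition cover_instance : instance R n :=
  Instance adj_ord_sym adj_ord_irr adj_ord_connected
    (fun u v _ => edge_weight_ge0 [set u; v]) (@ord_inj n).

Local Notation I := cover_instance.
Implicit Types (H : {set {set 'I_n}}) (C D : {set Q}).

Lemma adj_var q q' : q = q' \/ E q q' ->
  vadj (var_vtx q false) (var_vtx q' true).
Proof. by move=> [->|e] /=; [rewrite eqxx|case: eqVneq]. Qed.

Lemma edges_enc u v : vadj u v -> [set enc u; enc v] \in edges I.
Proof. by move=> uv; apply/imset2P; exists (enc u) (enc v); rewrite ?inE //= adj_enc. Qed.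

Lemma in_edgesP u v : [set u; v] \in edges I -> adj_ord u v.
Proof.
case/imset2P => u' v' _; rewrite inE /= => uv' e.
have uv0 : u' != v' by apply: contraTneq uv' => ->; rewrite adj_ord_irr.
by case: (set2_eq uv0 e) => -[-> ->] //; rewrite adj_ord_sym.
Qed.

Definition free_edge S : bool := (S \in edges I) && (edge_weight S == 0).

Definition cover_spanner C : {set {set 'I_n}} :=
  [set S | free_edge S] :|: [set var_edge q q | q in C].

Lemma edge_weight_pair u v :
  (forall q q', (u, v) <> (var_vtx q false, var_vtx q' true)) ->
  (forall q q', (u, v) <> (var_vtx q' true, var_vtx q false)) ->
  edge_weight [set enc u; enc v] = 0.
Proof.
move=> h1 h2; apply: contrapT => /eqP/edge_weight_neq0[q [q' e]].
case: (set2_eq (enc_var_neq _ _) e) => -[/enc_inj eu /enc_inj ev].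
  by apply: (h1 q q'); rewrite eu ev.
by apply: (h2 q q'); rewrite eu ev.
Qed.

Lemma cover_spanner_cost C : cost I (cover_spanner C) = #|C|%:R.
Proof.
rewrite /cost (bigID (fun S => S \in [set var_edge q q | q in C])) /= [X in _ + X]big1; last first.
  by move=> S; rewrite !inE => /andP[/orP[/andP[_ /eqP]|->]].
rewrite addr0 (eq_bigl (fun S => S \in [set var_edge q q | q in C])); last first.
  by move=> S /=; rewrite in_setU; case: (S \in imset _ _); rewrite ?orbT ?andbF.
rewrite big_imset /=; last by move=> q q' _ _ /var_edge_inj[].
by under eq_bigr => q _ do rewrite edge_weight_var eqxx; rewrite -sum1_card natr_sum.
Qed.

Definition is_cover C := forall q q', E q q' -> (q \in C) || (q' \in C).

(** A heavy edge is bridged by a free edge and the weight-1 edge of a covered endpoint; an unbought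
    weight-1 edge is bridged by its middle vertex. *)
Lemma cover_spannerP C : is_cover C -> spanner2 I (cover_spanner C).
Proof.
move=> coverC; split.
  apply/fintype.subsetP => S; rewrite !inE => /orP[/andP[]//|/imsetP[q _ ->]].
  by apply: edges_enc; apply: adj_var; left.
have free u v : vadj u v ->
    (forall q q', (u, v) <> (var_vtx q false, var_vtx q' true)) ->
    (forall q q', (u, v) <> (var_vtx q' true, var_vtx q false)) ->
    [set enc u; enc v] \in cover_spanner C.
  by move=> uv h1 h2; rewrite !inE /free_edge edges_enc // edge_weight_pair // eqxx.
have var q : q \in C -> [set enc (var_vtx q false); enc (var_vtx q true)] \in cover_spanner C.
  by move=> qC; rewrite in_setU; apply/orP; right; apply/imsetP; exists q.
have two q q' : q = q' \/ E q q' -> exists m,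
    [set enc (var_vtx q false); enc m] \in cover_spanner C /\
    [set enc m; enc (var_vtx q' true)] \in cover_spanner C.
  case=> [<-|e]; first by exists (mid_vtx q); split; apply: free => //=.
  have nq : q == q' = false by apply/negbTE; apply: contraTneq e => ->; rewrite E_irr.
  case/orP: (coverC _ _ e) => [qC|qC].
    by exists (var_vtx q true); split; [exact: var|apply: free => //=; rewrite nq].
  by exists (var_vtx q' false); split; [apply: free => //=; rewrite nq|exact: var].
move=> u v uv.
have [/eqP w0|/edge_weight_neq0[q [q' e]]] := boolP (edge_weight [set u; v] == 0).
  exists [:: v]; split=> //=; rewrite andbT !inE /free_edge w0 eqxx andbT.
  by rewrite -(decK u) -(decK v) edges_enc.
have qq' : q = q' \/ E q q'.
  have : adj_ord (enc (var_vtx q false)) (enc (var_vtx q' true)).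
    by apply: in_edgesP; rewrite -[X in X \in _]e -(decK u) -(decK v) edges_enc.
  by rewrite adj_enc /=; case: eqVneq => [|_]; [left|right].
have [m [m1 m2]] := two _ _ qq'.
case: (set2_eq (enc_var_neq _ _) e) => -[-> ->].
  by exists [:: enc m; enc (var_vtx q' true)]; rewrite /= m1 m2.
exists [:: enc m; enc (var_vtx q false)]; split=> //=.
by rewrite setUC m2 setUC m1.
Qed.

Definition var_cover H : {set Q} := [set q | var_edge q q \in H].

(** Look at the midpoint of the path replacing the heavy edge from [q] to [q']: with no heavy edge
    available, it is the other end of [q] or of [q'], so the weight-1 edge of that vertex lies in
    [H]. *)
Lemma spanner_is_cover H : spanner2 I H ->
  (forall q q', var_edge q q' \in H -> q = q') -> is_cover (var_cover H).
Proof.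
move=> [/fintype.subsetP Hsub spanH] Hvar q q' e.
have nq : q <> q' by move=> qq; rewrite qq E_irr in e.
have adjqq : adj I (enc (var_vtx q false)) (enc (var_vtx q' true)).
  by rewrite /= adj_enc; apply: adj_var; right.
have [[|m [|m' [|m'' p']]] [/= pth]] := spanH _ _ adjqq.
- by move=> /enc_inj.
- by move: pth; rewrite andbT => + em; rewrite em => /Hvar.
- move: pth => /and3P[h1 h2 _] em _; rewrite em in h2 => {em}.
  move: h1 h2 (in_edgesP (Hsub _ h1)) (in_edgesP (Hsub _ h2)).
  rewrite -(decK m) !adj_enc; case: (dec m) => [[r [[]|]]|[b|i]] //=.
  + by move=> /[dup] /Hvar <-; rewrite inE => ->.
  + by move=> _ /[dup] /Hvar ->; rewrite !inE => ->; rewrite orbT.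
  + by move=> _ _ /eqP <- /eqP /nq.
- by [].
Qed.

Hypothesis card_lt : (#|Q| < n)%N.

Lemma cost_ge_weight H S : S \in H -> edge_weight S <= cost I H.
Proof.
move=> SH; rewrite /cost (bigD1 S) //= lerDl.
by apply: sumr_ge0 => S' _; exact: edge_weight_ge0.
Qed.

Lemma card_var_cover_le H : #|var_cover H|%:R <= cost I H.
Proof.
rewrite -(cover_spanner_cost (var_cover H)) /cost.
rewrite (bigID (fun S => S \in H)) /= [X in _ + X]big1 ?addr0; last first.
  move=> S; rewrite !inE => /andP[/orP[/andP[_ /eqP]//|/imsetP[q + ->]]].
  by rewrite inE => ->.
rewrite [leRHS](bigID (fun S => S \in cover_spanner (var_cover H))) /=.
rewrite -[leLHS]addr0; apply: lerD.
  by rewrite le_eqVlt; apply/orP; left; apply/eqP; apply: eq_bigl => S; rewrite andbC.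
by apply: sumr_ge0 => S' _; exact: edge_weight_ge0.
Qed.

(** The cover by all vertices gives a spanner of cost [#|Q| < n], cheaper than one heavy edge. *)
Lemma min_spanner_no_heavy H : min_spanner2 I H ->
  forall q q', var_edge q q' \in H -> q = q'.
Proof.
move=> [_ minH] q q' /cost_ge_weight; rewrite edge_weight_var; case: eqVneq => // _.
have covT : is_cover [set: Q] by move=> ? ?; rewrite !inE.
have := minH _ (cover_spannerP covT); rewrite cover_spanner_cost cardsT => h1 h2.
by have := le_trans h2 h1; rewrite ler_nat leqNgt card_lt.
Qed.

Definition independent D := {in D &, forall q q', ~~ E q q'}.

Lemma min_spanner_independent H : min_spanner2 I H -> independent (~: var_cover H).
Proof.
move=> mH q q'; rewrite !inE => qH q'H; apply/negP => e.
have := spanner_is_cover (proj1 mH) (min_spanner_no_heavy mH) e.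
by rewrite !inE (negbTE qH) (negbTE q'H).
Qed.

Lemma min_spanner_card H D : min_spanner2 I H -> independent D ->
  (#|D| + #|var_cover H| <= #|Q|)%N.
Proof.
move=> [_ minH] indD.
have covD : is_cover (~: D).
  move=> q q' e; rewrite !inE -negb_and; apply/negP => /andP[qD q'D].
  by have := indD _ _ qD q'D; rewrite e.
have := le_trans (card_var_cover_le H) (minH _ (cover_spannerP covD)).
by rewrite cover_spanner_cost ler_nat -(cardsC D) leq_add2l.
Qed.

End VertexCoverSpanner.

(** * The lower bound graph *)

Section Gadget.
Variables (k L : nat) (code : 'I_k -> 'I_L -> bool).
Hypothesis code_inj : forall i i', code i =1 code i' -> i = i'.
Implicit Types (x y : {set 'I_k * 'I_k}).

(* A vertex [(a, (s, u))] lies on Alice's side iff [a], and concerns the rows iff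
   [s]; [u] is an index, or a literal [(l, c)], adjacent to the indices whose bit
   [l] is [c]. *)
Definition gvtx : finType := (bool * (bool * ('I_k + 'I_L * bool)))%type.

(** The inputs only matter between row and column indices of one side; the edges across the cut join
    opposite literals of one bit, whatever the inputs. *)
Definition gadj x y : rel gvtx := fun p q =>
  let: (a, (s, u)) := p in let: (b, (r, v)) := q in
  match u, v with
  | inl i, inl i' => (a == b) &&
      (if s == r then i != i'
       else (if s then (i, i') else (i', i)) \notin (if a then x else y))
  | inl i, inr (l, c) => [&& a == b, s == r & c == code i l]
  | inr (l, c), inl i => [&& a == b, s == r & c == code i l]
  | inr (l, c), inr (l', c') => [&& a != b, s == r, l == l' & c != c']
  end.

Lemma gadj_sym x y : symmetric (gadj x y).
Proof.
move=> [a [s [i|[l c]]]] [b [r [i'|[l' c']]]] /=; rewrite (eq_sym b a) (eq_sym r s).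
- case: eqVneq => //= <-; case: eqVneq => [_|]; first by rewrite eq_sym.
  by case: s; case: r.
- by [].
- by [].
- by rewrite (eq_sym l' l) (eq_sym c' c).
Qed.

Lemma gadj_irr x y : irreflexive (gadj x y).
Proof. by move=> [a [s [i|[l c]]]] /=; rewrite !eqxx. Qed.

Definition block : finType := (bool * bool + bool * ('I_L * bool))%type.

Lemma card_block : #|block| = (4 + 4 * L)%N.
Proof. by rewrite card_sum !card_prod card_bool card_ord; lia. Qed.

(* Fibers are cliques: the indices of one side, or a literal of one side together
   with the opposite literal of the other. *)
Definition block_of (p : gvtx) : block :=
  let: (a, (s, u)) := p in
  match u with
  | inl _ => inl (a, s)
  | inr (l, c) => inr (s, (l, c (+) a))
  end.

Lemma block_clique x y p q : block_of p = block_of q -> p != q -> gadj x y p q.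
Proof.
case: p q => [a [s [i|[l c]]]] [b [r [i'|[l' c']]]] //=.
  by case=> -> -> ne; rewrite !eqxx /=; apply: contra_neq ne => ->.
case=> -> -> /eqP; rewrite !eqxx /=.
by case: a; case: b; case: c; case: c' => //= _; rewrite eqxx.
Qed.

Lemma independent_block_inj x y (D : {set gvtx}) :
  independent (gadj x y) D -> {in D &, injective block_of}.
Proof.
move=> indD p q pD qD e; apply: contraTeq (indD p q pD qD) => ne.
by rewrite negbK block_clique.
Qed.

(** The [4 + 4 * L] blocks are cliques, so [D] meets each of them: it holds a row and a column on
    each side, and a literal from every literal block. *)
Lemma large_independent x y (D : {set gvtx}) :
  independent (gadj x y) D -> (4 + 4 * L <= #|D|)%N -> x :&: y != set0.
Proof.
move=> indD large.
have img : block_of @: D = [set: block].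
  apply/eqP; rewrite eqEcard subsetT cardsT card_block.
  by rewrite card_in_imset //; exact: independent_block_inj indD.
have hit B : exists2 p, p \in D & B = block_of p.
  by apply/imsetP; rewrite img inE.
have idx a s : exists i, (a, (s, inl i)) \in D.
  have [[b [r [i|[l c]]]] pD //= [-> ->]] := hit (inl (a, s)).
  by exists i.
(* Alice's literal for bit [l] of [i] is adjacent to [i], so from its block [D] holds Bob's opposite
   literal, which excludes every [i'] whose bit [l] differs. *)
have agree s i i' : (true, (s, inl i)) \in D -> (false, (s, inl i')) \in D -> i = i'.
  move=> iD i'D; apply: code_inj => l.
  have [[b [r [//|[l' c]]]] /= pD [es el ec]] := hit (inr (s, (l, code i l (+) true))).
  subst r l'; case: b pD ec => pD.
    move=> /addIb ec; subst c.
    by have := indD _ _ iD pD; rewrite /= !eqxx.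
  rewrite addbT addbF => ec.
  by have := indD _ _ i'D pD; rewrite /= !eqxx /= -ec; case: (code i l); case: (code i' l).
have [i iD] := idx true true; have [j jD] := idx true false.
have [i' i'D] := idx false true; have [j' j'D] := idx false false.
have ii := agree _ _ _ iD i'D; have jj := agree _ _ _ jD j'D; subst i' j'.
apply/set0Pn; exists (i, j); rewrite inE; apply/andP; split.
  by have := indD _ _ iD jD; rewrite /= negbK.
by have := indD _ _ i'D j'D; rewrite /= negbK.
Qed.

Lemma intersecting_independent x y : x :&: y != set0 ->
  exists2 D : {set gvtx}, independent (gadj x y) D & (4 + 4 * L <= #|D|)%N.
Proof.
case/set0Pn => -[i j]; rewrite inE => /andP[ijx ijy].
pose D : {set gvtx} := [set p | match p.2.2 with
  | inl i' => i' == (if p.2.1 then i else j)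
  | inr (l, c) => c == ~~ code (if p.2.1 then i else j) l end].
exists D.
  move=> [a [s [u|[l c]]]] [b [r [v|[l' c']]]]; rewrite !inE /=.
  - move=> /eqP-> /eqP->; case: a; case: b; case: s; case: r => //=;
    by rewrite ?eqxx ?ijx ?ijy.
  - move=> /eqP-> /eqP->; case: eqVneq => //= _; case: eqVneq => //= <-.
    by case: (code _ _).
  - move=> /eqP-> /eqP->; case: eqVneq => //= _; case: eqVneq => //= <-.
    by case: (code _ _).
  - move=> /eqP-> /eqP->; case: eqVneq => //= _; case: eqVneq => //= <-.
    by case: eqVneq => //= <-; rewrite eqxx.
rewrite -card_block -cardsT.
suff -> : [set: block] = block_of @: D by exact: leq_imset_card.
apply/esym/eqP; rewrite -subTset; apply/fintype.subsetP => -[[a s]|[s [l c]]] _; apply/imsetP.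
  by exists (a, (s, inl (if s then i else j))); rewrite ?inE /=.
set e := ~~ code (if s then i else j) l.
(* In the block [(s, (l, c))], the literal of value [e] is the one on side [c (+) e]. *)
exists (c (+) e, (s, inr (l, e))); first by rewrite inE /=.
by rewrite /= addbCA addbb addbF.
Qed.

End Gadget.

(** * Transcripts across the cut *)

Section Simulation.
Variables (R : realType) (Om : Type) (b n : nat) (A : program R Om b).
Implicit Types (I : instance R n) (v u : 'I_n).

Lemma eq_table I I' X v (f f' : 'I_n -> X) :
  ident I =1 ident I' -> adj I v =1 adj I' v ->
  (forall u, adj I v u -> f u = f' u) -> table I v f = table I' v f'.
Proof.
move=> eqid eqadj eqf; apply/funext => j; rewrite /table.
have <- : [pick u | adj I v u && (ident I u == j)] = [pick u | adj I' v u && (ident I' u == j)].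
  by apply: eq_pick => u /=; rewrite eqadj eqid.
by case: pickP => //= u /andP[vu _]; rewrite eqf.
Qed.

Variables (I1 I2 I3 : instance R n) (S : pred 'I_n).
Hypotheses (id12 : ident I1 =1 ident I2) (id13 : ident I1 =1 ident I3).
Hypotheses (w13 : weight I1 = weight I3) (w23 : weight I2 = weight I3).
Hypothesis adj13 : forall v, S v -> adj I3 v =1 adj I1 v.
Hypothesis adj23 : forall v, ~~ S v -> adj I3 v =1 adj I2 v.

(** Induction on rounds: inside [S] the hybrid [I3] has the neighbourhoods of [I1], outside those of
    [I2], and the messages crossing the cut agree in both runs. *)
Lemma eq_run_cut t w :
  (forall r, (r < t)%N -> forall u v, S u != S v -> adj I3 u v ->
     send (run A I1 r w u) (ident I3 v) = send (run A I2 r w u) (ident I3 v)) ->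
  forall r, (r <= t)%N -> forall v,
    run A I3 r w v = if S v then run A I1 r w v else run A I2 r w v.
Proof.
move=> msg; have id32 : ident I3 =1 ident I2 by move=> v; rewrite -id13 id12.
elim=> [|r IHr] rt v.
  rewrite /run /= /start; case: ifP => [Sv|/negbT Sv].
    rewrite -id13; congr init; apply: eq_table; [by move=> u; rewrite id13|exact: adj13|].
    by move=> u _; rewrite w13.
  rewrite id32; congr init; apply: eq_table; [exact: id32|exact: adj23|].
  by move=> u _; rewrite w23.
rewrite /run !iterS -!/(run _ _ _ _) /round IHr ?(ltnW rt) //.
case: ifP => [Sv|/negbT Sv]; congr recv; apply: eq_table.
- by move=> u; rewrite id13.
- exact: adj13.
- move=> u vu; rewrite id13 IHr ?(ltnW rt) //; case: ifP => // Su.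
  rewrite msg //; first by rewrite Su Sv.
  by rewrite adj_sym.
- exact: id32.
- exact: adj23.
- move=> u vu; rewrite -id32 IHr ?(ltnW rt) //; case: ifP => // Su.
  rewrite msg //; first by rewrite Su (negbTE Sv).
  by rewrite adj_sym.
Qed.

End Simulation.

Section Transcript.
Variables (R : realType) (Om : Type) (b n : nat) (A : program R Om b).
Variables (k L p : nat) (code : 'I_k -> 'I_L -> bool).
Hypothesis code_inj : forall i i', code i =1 code i' -> i = i'.
Hypothesis card_vtx : #|vtx (gvtx k L) p| = n.
Implicit Types (x y : {set 'I_k * 'I_k}).

Local Notation Q := (gvtx k L).
Local Notation V := (vtx Q p).

Definition disj_instance x y : instance R n :=
  cover_instance R (@fst bool _) (gadj_sym code x y) card_vtx.

Definition vside (v : V) : bool :=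
  match v with inl (q, _) => q.1 | inr (inl a) => a | inr (inr _) => true end.

Local Notation gvadj x y := (vadj (gadj code x y) (@fst bool _)).

Lemma vadj_left x y y' (u v : V) : vside u -> gvadj x y u v = gvadj x y' u v.
Proof.
case: u v => [[[a [s [i|[l c]]]] [e|]]|[a|j]] [[[a' [s' [i'|[l' c']]]] [e'|]]|[a'|j']] //= ->.
by [].
Qed.

Lemma vadj_right x x' y (u v : V) : ~~ vside u -> gvadj x y u v = gvadj x' y u v.
Proof.
case: u v => [[[a [s [i|[l c]]]] [e|]]|[a|j]] [[[a' [s' [i'|[l' c']]]] [e'|]]|[a'|j']] //= /negbTE->.
by [].
Qed.

(* The directed edges across the cut: [(a, None)] joins the hubs, and
   [(a, Some (s, (l, c), (e, e')))] the ends [e] and [e'] of opposite literals. *)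
Definition link : finType := (bool * option (bool * ('I_L * bool) * (bool * bool)))%type.

Lemma card_link : #|link| = (32 * L + 2)%N.
Proof. by rewrite card_prod card_option !card_prod !card_bool card_ord; clear; lia. Qed.

Definition link_ends (c : link) : V * V :=
  match c with
  | (a, None) => (hub_vtx _ _ a, hub_vtx _ _ (~~ a))
  | (a, Some (s, (l, c), (e, e'))) =>
      (var_vtx _ (a, (s, inr (l, c))) e, var_vtx _ (~~ a, (s, inr (l, ~~ c))) e')
  end.

Lemma link_endsP x y u v : vside u != vside v -> gvadj x y u v ->
  exists c, link_ends c = (u, v).
Proof.
case: u v => [[[a [s [i|[l c]]]] [e|]]|[a|j]] [[[a' [s' [i'|[l' c']]]] [e'|]]|[a'|j']] //=.
all: try by move=> /negbTE ne; rewrite ?ne ?[a' == a]eq_sym ?ne ?xpair_eqE ?ne.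
- move=> ne; rewrite xpair_eqE (negbTE ne) /= => /and3P[/eqP<- /eqP<- cc].
  exists (a, Some (s, (l, c), (e, e'))) => /=.
  have -> : a' = ~~ a by move: ne; case: a; case: a'.
  by have -> : c' = ~~ c by move: cc; case: c; case: c'.
- by move=> ne _; exists (a, None); move: ne; case: a; case: a'.
- by case: a.
- by case: a'.
Qed.

Variable t : nat.

(** All messages over the cut, then for each player the number of weight-1 edges chosen on its side;
    the two counts add up to the size of the cover. *)
Definition transcript_type : finType :=
  ({ffun 'I_t * link -> b.-bseq bool} * ('I_n.+1 * 'I_n.+1))%type.

Local Notation en := (enc card_vtx).

Definition picked x y w : {set Q} :=
  [set q | selects A (disj_instance x y) t w (en (var_vtx p q false)) (en (var_vtx p q true))
        || selects A (disj_instance x y) t w (en (var_vtx p q true)) (en (var_vtx p q false))].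

Definition transcript w x y : transcript_type :=
  ([ffun c : 'I_t * link =>
      send (run A (disj_instance x y) c.1 w (en (link_ends c.2).1)) (en (link_ends c.2).2)],
   (inord #|[set q in picked x y w | q.1]|, inord #|[set q in picked x y w | ~~ q.1]|)).

Lemma pickedE x y w :
  picked x y w = var_cover card_vtx (result A (disj_instance x y) t w).
Proof.
apply/setP => q; rewrite !inE; apply/idP/imset2P => [/orP[] sel|[u v _]].
- exists (en (var_vtx p q false)) (en (var_vtx p q true)); rewrite ?inE //= sel andbT.
  by rewrite /adj_ord !encK /= eqxx.
- exists (en (var_vtx p q true)) (en (var_vtx p q false)); rewrite ?inE //= ?sel ?andbT.
    by rewrite /adj_ord !encK /= eqxx.
  by rewrite /var_edge setUC.
- rewrite inE /= => /andP[_ sel] /esym e.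
  by case: (set2_eq (enc_var_neq card_vtx _ _) e) => -[<- <-]; rewrite sel ?orbT.
Qed.

Lemma transcript_run w x y x' y' : transcript w x y = transcript w x' y' ->
  forall r, (r <= t)%N -> forall v, run A (disj_instance x y') r w v =
    if vside (dec card_vtx v) then run A (disj_instance x y) r w v
    else run A (disj_instance x' y') r w v.
Proof.
move=> /(congr1 fst)/ffunP eqm.
apply: (@eq_run_cut _ _ _ _ A (disj_instance x y) (disj_instance x' y') (disj_instance x y')
  (fun v => vside (dec card_vtx v))) => //=.
- by move=> v Sv u; exact: vadj_left.
- by move=> v Sv u; exact: vadj_right.
- move=> r rt u v Suv; rewrite /adj_ord => uv.
  have [c ce] := link_endsP Suv uv.
  have := eqm (Ordinal rt, c).
  by rewrite !ffunE [(_, c).1]/= [(_, c).2]/= ce [(_, _).1]/= [(_, _).2]/= !decK => ->.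
Qed.

(** On [(x, y')] Alice's half runs as on [(x, y)] and Bob's as on [(x', y')], and each entry of the
    transcript depends on one half only. *)
Lemma transcript_rect w x y x' y' : transcript w x y = transcript w x' y' ->
  transcript w x y' = transcript w x y.
Proof.
move=> eqT; have runE := transcript_run eqT.
have eqm := congr1 fst eqT.
have eqB : (transcript w x' y').2.2 = (transcript w x y).2.2 by rewrite eqT.
have vside_var q e : vside (var_vtx p q e) = q.1 by [].
have pickT : [set q in picked x y' w | q.1] = [set q in picked x y w | q.1].
  apply/setP => q; rewrite !inE; case: (boolP q.1) => q1; last by rewrite !andbF.
  by rewrite /selects !(runE _ (leqnn t)) !encK !vside_var q1.
have pickF : [set q in picked x y' w | ~~ q.1] = [set q in picked x' y' w | ~~ q.1].
  apply/setP => q; rewrite !inE; case: (boolP q.1) => q1; first by rewrite !andbF.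
  by rewrite /selects !(runE _ (leqnn t)) !encK !vside_var (negbTE q1).
rewrite /transcript pickT pickF; congr (_, (_, _)); last exact: eqB.
apply/ffunP => -[r c]; rewrite !ffunE [(r, c).1]/= [(r, c).2]/=.
rewrite (runE _ (ltnW (ltn_ord r))) encK; case: (vside _); first by [].
by have /ffunP/(_ (r, c)) := eqm; rewrite !ffunE [(r, c).1]/= [(r, c).2]/= => ->.
Qed.

(** For an optimal spanner the unpicked vertices form a maximum independent set; the test asks,
    without subtraction, whether it is as large as the number of blocks. *)
Definition accepts (T : transcript_type) : bool :=
  (4 + 4 * L + (T.2.1 + T.2.2) <= #|Q|)%N.

Hypothesis card_lt : (#|Q| < n)%N.

Lemma transcript_correct w x y :
  min_spanner2 (disj_instance x y) (result A (disj_instance x y) t w) ->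
  accepts (transcript w x y) = (x :&: y != set0).
Proof.
set H := result _ _ _ _ => mH.
(* The counts are in range, so [inord] never falls back to its default. *)
have leQ (D : {set Q}) : (#|D| < n.+1)%N.
  by rewrite ltnS (leq_trans (max_card _)) // ltnW.
have cE : ((transcript w x y).2.1 + (transcript w x y).2.2 = #|var_cover card_vtx H|)%N.
  rewrite /= !inordK ?leQ // -pickedE -(cardsID [set q : Q | q.1] (picked x y w)).
  by congr (_ + _)%N; apply: eq_card => q; rewrite !inE // andbC.
rewrite /accepts cE.
have ind := min_spanner_independent (gadj_irr code x y) card_lt mH.
have cC := cardsC (var_cover card_vtx H).
apply/idP/idP => [le|/(intersecting_independent code)[D indD leD]].
  by apply: (large_independent code_inj ind); lia.
have := min_spanner_card (gadj_irr code x y) mH indD; lia.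
Qed.

End Transcript.

From mathcomp Require Import classical_sets.
Local Open Scope classical_set_scope.
Local Open Scope ring_scope.

(** * Randomized algorithms *)

Section FiniteObservable.
Variables (R : realType) (d : measure_display) (Om : measurableType d).
Variables (P : probability Om R) (U : finType) (X : Om -> U).
Hypothesis X_meas : forall u, measurable [set w | X w = u].

Lemma cons_event u (s : seq U) :
  [set w | X w \in u :: s] = [set w | X w = u] `|` [set w | X w \in s].
Proof.
apply/seteqP; split=> w /=; rewrite inE; first by case/orP=> [/eqP|]; [left|right].
by case=> ->; rewrite ?eqxx ?orbT.
Qed.

Lemma measurable_seq_event (s : seq U) : measurable [set w | X w \in s].
Proof.
elim: s => [|u s IHs].
  by rewrite [X in measurable X](_ : _ = set0) //; apply/seteqP; split.
rewrite cons_event; exact: measurableU.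
Qed.

Lemma prob_seq_event (s : seq U) : uniq s ->
  P [set w | X w \in s] = (\sum_(u <- s) P [set w | X w = u])%E.
Proof.
elim: s => [_|u s IHs /= /andP[us /IHs {}IHs]].
  rewrite big_nil [X in P X](_ : _ = set0) ?measure0 //.
  by apply/seteqP; split.
rewrite cons_event measureU //; first by rewrite big_cons; congr (_ + _)%E; exact: IHs.
- exact: measurable_seq_event.
- by apply/seteqP; split=> w //= [->]; rewrite (negbTE us).
Qed.

Lemma measurable_finite_event (G : pred U) : measurable [set w | G (X w)].
Proof.
have -> : [set w | G (X w)] = [set w | X w \in enum G].
  by apply/seteqP; split=> w /=; rewrite mem_enum.
exact: measurable_seq_event.
Qed.

Lemma prob_finite_event (G : pred U) :
  fine (P [set w | G (X w)]) = \sum_(u | G u) fine (P [set w | X w = u]).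
Proof.
have -> : [set w | G (X w)] = [set w | X w \in enum G].
  by apply/seteqP; split=> w /=; rewrite mem_enum.
rewrite prob_seq_event ?enum_uniq // -sum_fine; last by move=> u _; exact: fin_num_measure.
by rewrite big_enum.
Qed.

End FiniteObservable.

(** * Solving within [t] rounds as an event on a finite outcome *)

Section SolvesWithin.
Variables (R : realType) (d : measure_display) (Om : measurableType d).
Variables (P : probability Om R) (b n : nat) (A : program R Om b).
Implicit Types I : instance R n.

Definition outcome I t w : option {set {set 'I_n}} :=
  if `[< halted A I t w >] then Some (result A I t w) else None.

Lemma outcome_SomeP I t w H :
  outcome I t w = Some H <-> halted A I t w /\ result A I t w = H.
Proof.
rewrite /outcome; case: asboolP => h; split=> //; first by case.
- by case=> _ ->.
- by case.
Qed.

Lemma measurable_outcome I t : measurable_result A I ->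
  forall o, measurable [set w | outcome I t w = o].
Proof.
move=> mI.
have mSome H : measurable [set w | outcome I t w = Some H].
  have -> : [set w | outcome I t w = Some H] = [set w | halted A I t w /\ result A I t w = H].
    by apply/seteqP; split=> w /=; rewrite outcome_SomeP.
  exact: mI.
case=> [H|]; first exact: mSome.
have -> : [set w | outcome I t w = None] =
    ~` (\big[setU/set0]_(H : {set {set 'I_n}}) [set w | outcome I t w = Some H]).
  apply/seteqP; split=> w /=.
    by move=> oN; rewrite -bigcup_seq => -[H _] /=; rewrite oN.
  case e: (outcome I t w) => [H|] // []; rewrite -bigcup_seq; exists H => //=.
  by rewrite mem_index_enum.
by apply: measurableC; exact: bigsetU_measurable.
Qed.

Definition optimal I (o : option {set {set 'I_n}}) : bool :=
  if o is Some H then `[< min_spanner2 I H >] else false.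

Lemma solved_outcome I t : [set w | halted A I t w /\ min_spanner2 I (result A I t w)] =
  [set w | optimal I (outcome I t w)].
Proof.
apply/seteqP; split=> w /=; rewrite /outcome; case: asboolP => h //=.
- by case=> _ m; apply/asboolP.
- by case.
- by move/asboolP.
Qed.

Lemma run_stable I t t' w v o : (t <= t')%N ->
  output (run A I t w v) = Some o -> output (run A I t' w v) = Some o.
Proof.
move=> /subnK <-; elim: (t' - t)%N => [|r IHr] //= /IHr e.
exact: output_stable.
Qed.

(** Outputs are irrevocable, so the success event only grows with time. *)
Lemma solves_within_mono I t t' : measurable_result A I -> (t <= t')%N ->
  solves_within P A I t -> solves_within P A I t'.
Proof.
move=> mI tt'; rewrite /solves_within => /le_trans; apply.
apply: le_measure; rewrite ?inE ?solved_outcome.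
- by apply: measurable_finite_event => o; exact: measurable_outcome.
- by apply: measurable_finite_event => o; exact: measurable_outcome.
rewrite -!solved_outcome => w [h m].
have outE v : output (run A I t' w v) = output (run A I t w v).
  case e: (output (run A I t w v)) => [out|]; first exact: run_stable e.
  by have := h v; rewrite e.
split; first by move=> v; rewrite outE; exact: h.
suff selE : selects A I t' w = selects A I t w by rewrite /result selE.
by apply/funext => u; apply/funext => v; rewrite /selects outE.
Qed.

End SolvesWithin.

Section CommunicationBound.
Variables (R : realType) (d : measure_display) (Om : measurableType d).
Variables (P : probability Om R) (b n : nat) (A : program R Om b).
Variables (k L p : nat) (code : 'I_k -> 'I_L -> bool).
Hypothesis code_inj : forall i i', code i =1 code i' -> i = i'.
Hypothesis card_vtx : #|vtx (gvtx k L) p| = n.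
Hypothesis card_lt : (#|gvtx k L| < n)%N.
Variable t : nat.

Local Notation inst x y := (disj_instance R code card_vtx x y).
Local Notation input := {set 'I_k * 'I_k}.

Hypothesis meas_inst : forall x y, measurable_result A (inst x y).
Hypothesis solves_inst : forall x y, solves_within P A (inst x y) t.

(* Only the joint outcome on all inputs is measurable, so the probability space
   is replaced by the finite space of joint outcomes; each outcome of positive
   probability is represented by some point of [Om]. *)
Lemma transcript_lower_bound :
  (k * k)%:R <= 2304 * ln #|transcript_type b n L t|%:R :> R.
Proof.
pose Phi w : {ffun input * input -> option {set {set 'I_n}}} :=
  [ffun z => outcome A (inst z.1 z.2) t w].
have mPhi phi : measurable [set w | Phi w = phi].
  have -> : [set w | Phi w = phi] =
      \big[setI/setT]_(z : input * input) [set w | outcome A (inst z.1 z.2) t w = phi z].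
    rewrite -bigcap_seq; apply/seteqP; split=> w /=.
      by move=> <- z _ /=; rewrite ffunE.
    by move=> h; apply/ffunP => z; rewrite ffunE; apply: h => /=; rewrite mem_index_enum.
  by apply: bigsetI_measurable => z _; exact: measurable_outcome.
pose mu phi := fine (P [set w | Phi w = phi]).
have P1 : fine (P setT) = 1 by rewrite probability_setT.
have mu1 : \sum_phi mu phi = 1.
  by rewrite -(prob_finite_event P mPhi xpredT) -P1; congr (fine (P _)); apply/seteqP; split.
have mu0 phi : 0 <= mu phi by rewrite fine_ge0.
have [w0] : exists w0 : Om, True.
  apply: contrapT => no; have : P setT = 0%E.
    by rewrite [X in P X](_ : _ = set0) ?measure0 //; apply/seteqP; split=> // w _; apply: no; exists w.
  by rewrite probability_setT => /eqP; rewrite eqe oner_eq0.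
move=> _.
(* [w0] is a dummy for joint outcomes that never occur; these have probability 0. *)
have /choice[rep repP] phi : exists w, (exists w', Phi w' = phi) -> Phi w = phi.
  by have [[w e]|no] := pselect (exists w', Phi w' = phi); [exists w|exists w0].
have <- : #|{: 'I_k * 'I_k}| = (k * k)%N by rewrite card_prod card_ord.
apply: (@disjointness_lower_bound R _ _ _
  (fun phi x y => transcript A code card_vtx t (rep phi) x y) mu (@accepts _ _ k L t) mu0 mu1).
- by move=> w x y x' y'; exact: transcript_rect.
move=> x y; have := solves_inst x y; rewrite /solves_within solved_outcome.
have -> : [set w | optimal (inst x y) (outcome A (inst x y) t w)] =
    [set w | optimal (inst x y) (Phi w (x, y))].
  by apply/seteqP; split=> w /=; rewrite ffunE.
rewrite -(fineK (fin_num_measure P _ _)); last first.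
  exact: (measurable_finite_event mPhi (fun phi => optimal (inst x y) (phi (x, y)))).
rewrite lee_fin (prob_finite_event P mPhi (fun phi => optimal (inst x y) (phi (x, y)))).
move=> /le_trans; apply; rewrite big_mkcond /=; apply: ler_sum => phi _.
case: ifP => [opt|_]; last by rewrite mulr_ge0.
rewrite -/(mu phi); have [->|mu_neq0] := eqVneq (mu phi) 0; first by rewrite mul0r.
have ex : exists w', Phi w' = phi.
  apply: contrapT => no; move/eqP: mu_neq0; apply.
  rewrite /mu [X in P X](_ : _ = set0) ?measure0 //.
  by apply/seteqP; split=> // w /= e; apply: no; exists w.
move: opt; rewrite -(repP _ ex) ffunE /=.
case e: (outcome _ _ _ _) => [H|] //= /asboolP mH.
have [_ rE] := (outcome_SomeP _ _ _ _ _).1 e.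
by rewrite repP // (transcript_correct code_inj) // ?eqxx ?mulr1 ?rE.
Qed.

End CommunicationBound.

(** * The bound on the number of rounds *)

(** Encode a message by its length and its bits padded with [false]; then [b + 1 <= 2 ^ b]. *)
Lemma card_bseq_bool b : (#|{: b.-bseq bool}| <= 2 ^ (2 * b))%N.
Proof.
pose f (s : b.-bseq bool) : 'I_b.+1 * b.-tuple bool :=
  (inord (size s), [tuple nth false s i | i < b]).
have f_inj : injective f.
  move=> s s' e; apply: val_inj.
  have es := congr1 (fun r => val r.1) e; rewrite /= !inordK ?ltnS ?size_bseq // in es.
  apply: (@eq_from_nth _ false) => // i i_s.
  have ib : (i < b)%N := leq_trans i_s (size_bseq s).
  have := congr1 (fun r => tnth r.2 (Ordinal ib)) e.
  by rewrite /= !tnth_mktuple.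
apply: leq_trans (leq_card f f_inj) _.
rewrite card_prod card_ord card_tuple card_bool mul2n -addnn expnD leq_mul2r.
by rewrite ltn_expl ?orbT.
Qed.

Lemma card_transcript_type B n L t : (0 < L)%N -> (n < 2 ^ L.+1)%N ->
  (#|transcript_type (B * L) n L t| <= 2 ^ ((68 * B * t + 4) * L ^ 2))%N.
Proof.
move=> L0 nL; rewrite !card_prod card_ffun card_prod !card_ord card_link.
apply: (@leq_trans (2 ^ ((2 * (B * L)) * (t * (32 * L + 2))) * (2 ^ L.+1 * 2 ^ L.+1))).
  apply: leq_mul; last exact: leq_mul.
  rewrite (expnM 2); have [->|e0] := posnP (t * (32 * L + 2)); first by rewrite !expn0.
  by rewrite leq_exp2r ?card_bseq_bool.
rewrite -!expnD leq_exp2l //; nia.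
Qed.

(** * Estimates for logarithms *)

Section Numerics.
Variable R : realType.

Lemma ln2_ge : 1 / 2 <= ln 2 :> R.
Proof.
rewrite -ler_expR lnK ?posrE //.
have := expR_ge1Dx (- (1 / 2) : R); have := expRxMexpNx_1 (1 / 2 : R).
have := expR_gt0 (1 / 2 : R); move: (expR _) (expR _) => u v; nra.
Qed.

Lemma ln_le_sqrt (x : R) : 1 <= x -> ln x <= 2 * Num.sqrt x.
Proof.
move=> x1; have s0 : 0 < Num.sqrt x by rewrite sqrtr_gt0; lra.
rewrite -[in leLHS](@sqr_sqrtr _ x); last lra.
rewrite expr2 lnM ?posrE //.
by have := ln_sublinear s0; lra.
Qed.

(** [ln 2 >= 1 / 2] gives [(up_log 2 n).-1 <= 2 * ln n]; the remaining 1 is at most [ln n] because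
    [n >= 4]. *)
Lemma up_log2_le (n : nat) : (4 <= n)%N -> (up_log 2 n)%:R <= 3 * ln n%:R :> R.
Proof.
move=> n4; have /andP[lo _] := up_log_bounds (isT : 1 < 2)%N (leq_trans (isT : 1 < 4)%N n4).
have L0 : (0 < up_log 2 n)%N by rewrite up_log_gt0 //; lia.
have l2 := ln2_ge.
have : ln ((2 ^ (up_log 2 n).-1)%:R) <= ln n%:R :> R.
  by rewrite ler_ln ?posrE ?ltr0n ?expn_gt0 ?ler_nat ?(ltnW lo) //; lia.
have : ln (2 ^ 2)%:R <= ln n%:R :> R by rewrite ler_ln ?posrE ?ltr0n ?ler_nat //; lia.
rewrite !natrX !lnXn // -[ln 2 *+ 2]mulr_natr => h1.
rewrite -[ln 2 *+ _]mulr_natr => h2; rewrite -(prednK L0) -natr1.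
have := ler0n R (up_log 2 n).-1; move: (_.-1%:R) h2 => e; nra.
Qed.

Lemma ln_card_le (m e : nat) : (0 < m)%N -> (m <= 2 ^ e)%N -> ln m%:R <= e%:R :> R.
Proof.
move=> m0 me; apply: (@le_trans _ _ (ln (2 ^ e)%:R)).
  by rewrite ler_ln ?posrE ?ltr0n ?expn_gt0 ?ler_nat.
rewrite natrX lnXn // -[ln 2 *+ _]mulr_natr -[leRHS]mul1r ler_wpM2r //.
by have := @le_ln1Dx R 1; rewrite -[1 + 1]/(2 : R); apply; lra.
Qed.
End Numerics.

Section MainBound.
Variables (R : realType) (d : measure_display) (Om : measurableType d).
Variables (P : probability Om R) (B : nat).

(* [48] relates [k] to [n], [2304] comes from the disjointness bound and [9]
   from [up_log 2 n <= 3 * ln n]. *)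
Definition bound_const : R := 48 ^+ 2 * 2304 * 9.

Section FixedSize.
Variables (n L : nat) (A : program R Om (B * L)).
Variables (idmax : nat) (W : set R) (t : nat).
Hypotheses (idmax_ge : (n <= idmax)%N) (W_nat : forall i, (i <= n)%N -> W i%:R).
Hypotheses (L0 : (0 < L)%N) (nL : (n <= 2 ^ L)%N) (L_le : L%:R <= 3 * ln n%:R :> R).
Hypothesis fits : (48 * L + 4 <= n)%N.
Hypothesis meas : forall I : instance R n, admissible idmax W I -> measurable_result A I.
Hypothesis solves : forall I : instance R n, admissible idmax W I -> solves_within P A I t.

Lemma rounds_lower_bound :
  n%:R ^+ 2 / ln n%:R ^+ 2 <= bound_const * (68 * B%:R * t%:R + 4).
Proof.
(* Before padding there are [3 * (4 * k + 8 * L) + 2] vertices: [12 * k] is at most [n / 2], and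
   [fits] bounds the rest by [n / 2]. *)
pose k := (n %/ 24)%N.
have kn : (k <= 2 ^ L)%N by apply: leq_trans nL; rewrite /k leq_div.
have cardQ : #|gvtx k L| = (4 * k + 8 * L)%N.
  by rewrite !card_prod card_sum card_prod !card_ord card_bool; lia.
have k24 : (24 * k <= n < 24 * k + 24)%N.
  by rewrite /k; have := divn_eq n 24; have := ltn_pmod n (isT : 0 < 24)%N; lia.
pose p := (n - (3 * #|gvtx k L| + 2))%N.
have card_vtx : #|vtx (gvtx k L) p| = n.
  rewrite card_sum card_prod card_option card_sum card_bool card_ord /p; lia.
have card_lt : (#|gvtx k L| < n)%N by lia.
have kF : (k <= #|{ffun 'I_L -> bool}|)%N by rewrite card_ffun card_bool card_ord.
pose code (i : 'I_k) : 'I_L -> bool :=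
  (enum_val (widen_ord kF i) : {ffun 'I_L -> bool}).
have code_inj i i' : code i =1 code i' -> i = i'.
  by move=> /ffunP/enum_val_inj/(congr1 val)/= e; apply: val_inj.
have adm x y : admissible idmax W (disj_instance R code card_vtx x y).
  split=> [v|u v _] /=; first exact: leq_trans (ltn_ord v) idmax_ge.
  rewrite /edge_weight; case: ifP => _; first by apply: (W_nat (i := 1)); lia.
  by case: ifP => _; [exact: W_nat|exact: (W_nat (i := 0))].
have lb := transcript_lower_bound code_inj card_lt
  (fun x y => meas (adm x y)) (fun x y => solves (adm x y)).
have T0 : (0 < #|transcript_type (B * L) n L t|)%N.
  apply/card_gt0P; exists ([ffun=> insub_bseq _ [::]], (ord0, ord0)); exact: isT.
have nL1 : (n < 2 ^ L.+1)%N by apply: leq_ltn_trans nL _; rewrite ltn_exp2l.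
have lnT := ln_card_le R T0 (card_transcript_type B t L0 nL1).
have l0 : 0 < ln n%:R :> R.
  by apply: ln_gt0; rewrite ltr1n; lia.
have L9 : L%:R ^+ 2 <= 9 * ln n%:R ^+ 2 :> R.
  by have := ler0n R L; move: L_le l0; nra.
rewrite ler_pdivrMr ?exprn_gt0 //.
have nk : n%:R <= 48 * k%:R :> R by rewrite -natrM ler_nat; clear -fits k24 L0; lia.
have nk2 : n%:R ^+ 2 <= 48 ^+ 2 * (k * k)%:R :> R.
  by rewrite natrM -expr2 -exprMn lerXn2r ?nnegrE ?mulr_ge0 ?ler0n.
apply: (le_trans nk2); rewrite /bound_const.
have -> : 48 ^+ 2 * 2304 * 9 * (68 * B%:R * t%:R + 4) * ln n%:R ^+ 2 =
  48 ^+ 2 * (2304 * ((68 * B%:R * t%:R + 4) * (9 * ln n%:R ^+ 2))) :> R by ring.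
have p48 : 0 < 48 ^+ 2 :> R by rewrite exprn_gt0 ?ltr0n.
have p2304 : 0 < 2304 :> R by rewrite ltr0n.
rewrite (ler_pM2l p48); apply: (le_trans lb); rewrite (ler_pM2l p2304).
apply: (le_trans lnT); rewrite natrM natrX natrD !natrM ler_wpM2l //.
Qed.

End FixedSize.
End MainBound.

Theorem theorem18 (R : realType)
  (idmax : nat -> nat) (hid : forall n, (n <= idmax n)%N)
  (W : nat -> set R) (hW : forall n k, (k <= n)%N -> W n k%:R)
  (d : measure_display) (Om : measurableType d) (P : probability Om R)
  (B : nat) (A : forall n, program R Om (B * up_log 2 n))
  (hmeas : forall n (I : instance R n),
     admissible (idmax n) (W n) I -> measurable_result (A n) I)
  (hsolves : forall n (I : instance R n),
     admissible (idmax n) (W n) I -> exists t, solves_within P (A n) I t) :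
  exists c : R, 0 < c /\
  exists N : nat, forall n, (N <= n)%N ->
  exists I : instance R n, admissible (idmax n) (W n) I /\
    forall t, solves_within P (A n) I t ->
      c * (n%:R ^+ 2 / ln n%:R ^+ 2) <= t%:R.
Proof.
have [K KE K0] : exists2 K, K = bound_const R & 0 < K.
  by exists (bound_const R) => //; rewrite !mulr_gt0 ?exprn_gt0 ?ltr0n.
(* Chosen so that [68 * K * B * (c * r) <= r / 2]. *)
pose c : R := (136 * K * (B%:R + 1))^-1.
have B0 := ler0n R B.
have D0 : 0 < 136 * K * (B%:R + 1) by rewrite !mulr_gt0 ?ltr0n //; lra.
have c0 : 0 < c by rewrite invr_gt0.
(* With [ln n <= 2 * sqrt n], the term [32 * K] yields [r > 8 * K], and [300 * 300] yields
   [48 * up_log 2 n + 4 <= 300 * sqrt n <= n]. *)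
exists c; split=> //; exists (Num.truncn (32 * K + 300 * 300)).+1 => n Nn.
have n_ge : 32 * K + 300 * 300 <= n%:R.
  apply: le_trans (ltW (truncnS_gt _)) _; by rewrite ler_nat.
have s0 := sqrtr_ge0 (n%:R : R).
have s2 : Num.sqrt n%:R ^+ 2 = n%:R :> R by rewrite sqr_sqrtr.
have s300 : 300 <= Num.sqrt n%:R :> R by nra.
have n4 : (4 <= n)%N by rewrite -(ler_nat R); nra.
have l1 : 1 <= n%:R :> R by rewrite ler1n (leq_trans _ n4).
have ln_le := ln_le_sqrt l1.
have ln0 : 0 < ln n%:R :> R by apply: ln_gt0; rewrite ltr1n (leq_trans _ n4).
have L_le := up_log2_le R n4.
have fits : (48 * up_log 2 n + 4 <= n)%N.
  rewrite -(ler_nat R) natrD natrM; nra.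
set r := n%:R ^+ 2 / ln n%:R ^+ 2.
have r_large : 8 * K < r.
  rewrite /r ltr_pdivlMr ?exprn_gt0 //.
  have : ln n%:R ^+ 2 <= (2 * Num.sqrt n%:R) ^+ 2 :> R.
    by rewrite lerXn2r ?nnegrE ?mulr_ge0 // ltW.
  rewrite exprMn s2; move: (ln n%:R ^+ 2) => q q_le.
  have Kq : 0 <= K * (2 ^+ 2 * n%:R - q) by rewrite mulr_ge0 ?subr_ge0 // ltW.
  have nn : 0 <= n%:R * (n%:R - (32 * K + 300 * 300)) by rewrite mulr_ge0 ?subr_ge0.
  nra.
have r0 : 0 <= r by apply: ltW; apply: le_lt_trans r_large; rewrite mulr_ge0 // ltW.
have cr0 : 0 <= c * r by rewrite mulr_ge0 // ltW.
apply: contrapT => no.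
(* If no input is hard, each is solved in fewer than [c * r] rounds, hence by monotonicity all
   within [Num.truncn (c * r)]; the round bound then forces [r / 2 <= 4 * K]. *)
have solves (I : instance R n) : admissible (idmax n) (W n) I ->
    solves_within P (A n) I (Num.truncn (c * r)).
  move=> adm; apply: contrapT => nsol; apply: no; exists I; split=> // t st.
  rewrite leNgt; apply/negP => tc; apply: nsol.
  apply: (solves_within_mono (hmeas n I adm) _ st).
  by rewrite truncn_ge_nat // ltW.
have L0 : (0 < up_log 2 n)%N by rewrite up_log_gt0 // (leq_trans _ n4).
have := rounds_lower_bound (hid n) (@hW n) L0 (up_logP n (isT : 1 < 2)%N) L_le fits
  (hmeas n) solves.
rewrite -/r -KE.
have : (Num.truncn (c * r))%:R <= c * r by rewrite truncn_le.
move: ((Num.truncn (c * r))%:R : R) => T Tle rle.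
have KB : 68 * K * B%:R * (c * r) <= r / 2.
  rewrite mulrA.
  have -> : r / 2 = 1 / 2 * r by ring.
  apply: ler_wpM2r => //; rewrite /c ler_pdivrMr //; nra.
have KB0 : 0 <= 68 * K * B%:R by rewrite !mulr_ge0 ?ler0n // ltW.
have := ler_wpM2l KB0 Tle.
nra.
Qed.
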